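(* Let $\mathcal{F}$ be an antichain of graphs. If for some integer $\ell\ge \max\{|V(F)| : F\in \mathcal{F}\}$ there exists a walk-realizable $\mathcal{F}$-supporter $\Phi$ of order $\ell$, then $\operatorname{Forb}(\mathcal{F})$ is generalized spectrally closed.
   Context: All graphs are finite, simple and undirected, considered up to isomorphism. $A(G)$ is the adjacency matrix of $G$ and $\overline{G}$ its complement. Generalized spectral closedness: two graphs $G$ and $H$ are generalized cospectral if $A(G),A(H)$ have the same multiset of eigenvalues and $A(\overline{G}),A(\overline{H})$ have the same multiset of eigenvalues. A graph class $\mathcal{C}$ is generalized spectrally closed if no graph in $\mathcal{C}$ is generalized cospectral with a graph outside $\mathcal{C}$. Forbidden subgraphs: $\operatorname{Forb}(\mathcal{F})$ is the class of graphs containing no induced subgraph isomorphic to a member of $\mathcal{F}$. A family $\mathcal{F}$ is an antichain if for any two distinct (non-isomorphic) members, neither is isomorphic to an induced subgraph of the other. $\operatorname{ind}(H,G)$ is the number of induced subgraphs of $G$ isomorphic to $H$ (i.e. the number of vertex subsets $S\subseteq V(G)$ with $G[S]\cong H$). $\mathcal{U}_{\le \ell}$ is the set of isomorphism classes of nonempty graphs (at least one vertex) with at most $\ell$ vertices. $\beta$-closed walks: for $\beta=(\beta_1,\dots,\beta_k)\in\{0,1\}^k$, $k\ge 1$, a $\beta$-closed walk in $G$ is a sequence of vertices $v_1,\dots,v_{k+1}$ with $v_{k+1}=v_1$ such that for each $i\in\{1,\dots,k\}$, $v_iv_{i+1}$ is an edge of $G$ if $\beta_i=1$, and an edge of $\overline{G}$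 if $\beta_i=0$. $n_\beta(G)$ denotes the total number of $\beta$-closed walks in $G$. The dihedral group $D_k$ acts on $\{0,1\}^k$ by cyclic shifts and reversal; $\mathcal{B}_k\subset\{0,1\}^k$ is a fixed set containing exactly one representative of each orbit, and $\mathcal{B}_{\le \ell}=\bigcup_{k=1}^{\ell}\mathcal{B}_k$. Supporters: let $\mathcal{F}$ be an antichain and $\ell\ge\max\{|V(F)| : F\in\mathcal{F}\}$. A linear combination $\Phi(G)=\sum_{H\in \mathcal{U}_{\le \ell}}d_H\operatorname{ind}(H,G)$ with real coefficients $d_H$ is an $\mathcal{F}$-supporter of order $\ell$ if (i) $d_H\ge 0$ for all $H\in \mathcal{U}_{\le \ell}$; (ii) $d_H>0$ for all $H\in \mathcal{F}$; (iii) $d_H=0$ for all $H\in \operatorname{Forb}(\mathcal{F})\cap \mathcal{U}_{\le \ell}$. An $\mathcal{F}$-supporter $\Phi$ of order $\ell$ is walk-realizable if there exist real numbers $a_\beta$, $\beta\in\mathcal{B}_{\le \ell}$, such that $\Phi(G)=\sum_{\beta\in \mathcal{B}_{\le \ell}} a_\beta n_\beta(G)$ for every graph $G$. *)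

(* Defs.v *)
From HB Require Import structures.
From mathcomp Require Import all_boot all_order all_algebra all_field.
From mathcomp Require Import boolp reals.

Set Implicit Arguments.
Unset Strict Implicit.
Unset Printing Implicit Defensive.

Import Order.TTheory GRing.Theory Num.Theory.
Local Open Scope ring_scope.

Record sgraph := SGraph {
  vertex :> finType;
  adj : rel vertex;
  adj_sym : symmetric adj;
  adj_irr : irreflexive adj }.

Definition compl_adj (G : sgraph) : rel G := fun x y => (x != y) && ~~ adj x y.

Fact compl_adj_sym (G : sgraph) : symmetric (@compl_adj G).
Proof. by move=> x y; rewrite /compl_adj eq_sym adj_sym. Qed.

Fact compl_adj_irr (G : sgraph) : irreflexive (@compl_adj G).
Proof. by move=> x; rewrite /compl_adj eqxx. Qed.

Definition compl (G : sgraph) : sgraph :=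
  SGraph (@compl_adj_sym G) (@compl_adj_irr G).

Definition induced_adj (G : sgraph) (S : {set G}) : rel {x : G | x \in S} :=
  fun x y => adj (val x) (val y).

Fact induced_adj_sym (G : sgraph) (S : {set G}) : symmetric (induced_adj (S := S)).
Proof. by move=> x y; rewrite /induced_adj adj_sym. Qed.

Fact induced_adj_irr (G : sgraph) (S : {set G}) :
  irreflexive (induced_adj (S := S)).
Proof. by move=> x; rewrite /induced_adj adj_irr. Qed.

Definition induced (G : sgraph) (S : {set G}) : sgraph :=
  SGraph (@induced_adj_sym G S) (@induced_adj_irr G S).

Definition iso (G H : sgraph) : Prop :=
  exists2 f : G -> H, bijective f & forall x y, adj (f x) (f y) = adj x y.

(* Graphs are taken up to isomorphism: a class, or family, of graphs is an
   isomorphism-closed predicate. *)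
Definition iso_closed (F : sgraph -> Prop) : Prop :=
  forall G H, iso G H -> F G -> F H.

Definition induced_in (H G : sgraph) : Prop :=
  exists S : {set G}, iso (induced S) H.

Definition Forb (F : sgraph -> Prop) (G : sgraph) : Prop :=
  forall H, F H -> ~ induced_in H G.

Definition antichain (F : sgraph -> Prop) : Prop :=
  forall H H', F H -> F H' -> ~ iso H H' -> ~ induced_in H H'.

Definition ind (H G : sgraph) : nat :=
  #|[set S : {set G} | `[< iso (induced S) H >]]|.

(* The spectrum is taken in [algC]: the eigenvalues of a 0/1 matrix are
   algebraic numbers. *)
Definition adjmx (G : sgraph) : 'M[algC]_#|G| :=
  \matrix_(i, j) (adj (enum_val i) (enum_val j))%:R.

(* Eigenvalues with algebraic multiplicity, as the list (unique up to
   permutation) of the roots of the characteristic polynomial. *)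
Definition eigenvalues n (A : 'M[algC]_n) : seq algC :=
  sval (closed_field_poly_normal (char_poly A)).

Definition cospectral (G H : sgraph) : Prop :=
  perm_eq (eigenvalues (adjmx G)) (eigenvalues (adjmx H)).

Definition gen_cospectral (G H : sgraph) : Prop :=
  cospectral G H /\ cospectral (compl G) (compl H).

Definition gen_spectrally_closed (C : sgraph -> Prop) : Prop :=
  forall G H, C G -> ~ C H -> ~ gen_cospectral G H.

Section EdgeSet.
Variables (k : nat) (E : {set {set 'I_k}}).

Definition edge_adj : rel 'I_k := fun x y => (x != y) && ([set x; y] \in E).

Fact edge_adj_sym : symmetric edge_adj.
Proof. by move=> x y; rewrite /edge_adj eq_sym setUC. Qed.

Fact edge_adj_irr : irreflexive edge_adj.
Proof. by move=> x; rewrite /edge_adj eqxx. Qed.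

Definition edge_graph : sgraph := SGraph edge_adj_sym edge_adj_irr.
End EdgeSet.

(* One representative of each isomorphism class of graphs with k vertices.
   Members of E that are not pairs are ignored by [edge_graph], so distinct E may
   give the same graph; the transversal keeps only one of them. *)
Definition iso_reps (k : nat) : seq sgraph :=
  [seq edge_graph E | E : {set {set 'I_k}} in
    transversal
      (equivalence_partition
         (fun E E' : {set {set 'I_k}} => `[< iso (edge_graph E) (edge_graph E') >])
         [set: {set {set 'I_k}}])
      [set: {set {set 'I_k}}]].

Definition U_le (l : nat) : seq sgraph := flatten [seq iso_reps k | k <- iota 1 l].

Definition closed_walk k (b : k.-tuple bool) (G : sgraph)
    (v : {ffun 'I_k.+1 -> G}) : bool :=
  (v ord_max == v ord0) &&
  [forall i : 'I_k,
     let x := v (widen_ord (leqnSn k) i) in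
     let y := v (lift ord0 i) in
     if tnth b i then adj x y else compl_adj x y].

Definition n_walks k (b : k.-tuple bool) (G : sgraph) : nat :=
  #|[set v : {ffun 'I_k.+1 -> G} | closed_walk b v]|.

Definition dihedral_orbit k (s t : k.-tuple bool) : Prop :=
  exists i : nat, t = rot i s :> seq bool \/ t = rot i (rev s) :> seq bool.

Definition orbit_representatives k (B : {set k.-tuple bool}) : Prop :=
  forall s : k.-tuple bool, exists! t, t \in B /\ dihedral_orbit s t.

Section Supporters.
Variable R : realType.
Implicit Types (F : sgraph -> Prop) (l : nat) (Phi : sgraph -> R).

(* The coefficients are indexed by isomorphism classes: [d] is an invariant
   function, of which the sum only uses the values on U_{<= l}. *)
Definition supporter F l Phi : Prop :=
  exists d : sgraph -> R,
    [/\ forall G H, iso G H -> d G = d H,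
        forall G, Phi G = \sum_(H <- U_le l) d H * (ind H G)%:R,
        forall H : sgraph, (0 < #|H| <= l)%N -> 0 <= d H,
        forall H, F H -> 0 < d H
      & forall H : sgraph, Forb F H -> (0 < #|H| <= l)%N -> d H = 0].

Definition walk_realizable (B : forall k, {set k.-tuple bool}) l Phi : Prop :=
  exists a : forall k, k.-tuple bool -> R,
    forall G, Phi G =
      \sum_(1 <= k < l.+1) \sum_(b in B k) a k b * (n_walks b G)%:R.
End Supporters.

(* Main.v *)
(** Write A for the adjacency matrix of G and J for the all-ones matrix, so that
    the complement of G has adjacency matrix J - 1 - A.  The numbers of
    beta-closed walks are traces of products of A and J - 1 - A, hence integer
    combinations of traces of words in A and J.  As J X J = tr(J X) J, the
    trace of a word containing J is a product of numbers tr(J A^m).  The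
    spectra of G and its complement determine tr(A^k) and tr((J - A)^k); in the
    expansion of tr((J - A)^(m+1)) the words with a single J contribute
    (m+1) (-1)^m tr(J A^m), and all others are known by induction on m, which
    determines tr(J A^m).  So n_beta, and with it a walk-realizable supporter
    Phi, takes the same value on generalized cospectral graphs; and Phi
    vanishes exactly on Forb F. *)
Require Import Defs.
From HB Require Import structures.
From mathcomp Require Import all_boot all_order all_algebra all_field.
From mathcomp Require Import boolp reals.
From mathcomp Require Import ring.

Set Implicit Arguments.
Unset Strict Implicit.
Unset Printing Implicit Defensive.

Import Order.TTheory GRing.Theory Num.Theory.
Local Open Scope ring_scope.

(** * Traces of powers from the spectrum *)

Lemma conj_diag_expr (R : comUnitRingType) n (P : 'M[R]_n) (d : 'rV_n) k :
  P \in unitmx ->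
  (invmx P *m diag_mx d *m P) ^+ k =
  invmx P *m diag_mx (\row_i (d 0 i ^+ k)) *m P.
Proof.
move=> Pu; elim: k => [|k IHk].
  rewrite expr0 (_ : diag_mx _ = 1%:M) ?mulmx1 ?mulVmx //.
  by apply/matrixP=> i j; rewrite !mxE expr0.
rewrite exprS IHk -mulmxE !mulmxA mulmxK //; congr (_ *m _).
rewrite -!mulmxA mulmx_diag; congr (_ *m diag_mx _).
by apply/rowP=> i; rewrite !mxE exprS.
Qed.

Lemma char_poly_conj (R : comUnitRingType) n (P A : 'M[R]_n) :
  P \in unitmx -> char_poly (invmx P *m A *m P) = char_poly A.
Proof.
move=> Pu; rewrite /char_poly.
have VP : map_mx polyC (invmx P) *m map_mx polyC P = 1%:M.
  by rewrite -map_mxM mulVmx // map_mx1.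
have -> : char_poly_mx (invmx P *m A *m P) =
    map_mx polyC (invmx P) *m char_poly_mx A *m map_mx polyC P.
  rewrite /char_poly_mx mulmxBr mulmxBl scalar_mxC !map_mxM.
  by rewrite -[_%:M *m _ *m _]mulmxA VP mulmx1.
by rewrite !det_mulmx mulrAC -det_mulmx VP det1 mul1r.
Qed.

Lemma eigenvaluesE n (A : 'M[algC]_n) :
  char_poly A = \prod_(z <- eigenvalues A) ('X - z%:P).
Proof.
rewrite /eigenvalues; case: closed_field_poly_normal => /= r.
by rewrite (monicP (char_poly_monic A)) scale1r.
Qed.

(** A normal matrix is unitarily diagonalizable, and its spectral diagonal lists the roots of the
    characteristic polynomial, as [eigenvalues] does. *)
Lemma trace_expr_eigenvalues n (A : 'M[algC]_n) k :
  A \is normalmx -> \tr (A ^+ k) = \sum_(z <- eigenvalues A) z ^+ k.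
Proof.
move/orthomx_spectralP; set P := spectralmx A; set d := spectral_diag A => eqA.
have Pu : P \in unitmx by apply: spectral_unit.
have eig : perm_eq (eigenvalues A) [seq d 0 i | i <- enum 'I_n].
  apply: prod_XsubC_eq; rewrite -eigenvaluesE {1}eqA char_poly_conj //.
  rewrite char_poly_trig ?diag_mx_is_trig // big_map big_enum /=.
  by apply: eq_bigr => i _; rewrite mxE eqxx mulr1n.
rewrite (perm_big _ eig) big_map big_enum /= {1}eqA conj_diag_expr //.
rewrite mxtrace_mulC mulmxA mulmxV // mul1mx mxtrace_diag.
by apply: eq_bigr => i _; rewrite mxE.
Qed.

Lemma adjmx_normal (G : sgraph) : adjmx G \is normalmx.
Proof.
apply: symmetric_normalmx.
  apply/is_hermitianmxP; rewrite expr0 scale1r.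
  by apply/matrixP=> i j; rewrite !mxE adj_sym.
by apply/mxOverP=> i j; rewrite mxE rpred_nat.
Qed.

Lemma cospectral_trace (G H : sgraph) k :
  cospectral G H -> \tr (adjmx G ^+ k) = \tr (adjmx H ^+ k).
Proof.
by move=> coGH; rewrite !trace_expr_eigenvalues ?adjmx_normal // (perm_big _ coGH).
Qed.

Lemma adjmx_compl (G : sgraph) :
  adjmx (compl G) = const_mx 1 - 1 - adjmx G.
Proof.
apply/matrixP=> i j; rewrite !mxE /= /compl_adj (inj_eq enum_val_inj).
case: eqP => [->|_]; first by rewrite adj_irr subrr subr0.
by rewrite subr0; case: adj; rewrite ?subrr ?subr0.
Qed.

(** Serves to pass from J - 1 - A, the matrix of the complement, to J - A. *)
Lemma trace_expr_add1 (R : comPzRingType) m n (A : 'M[R]_m) (B : 'M[R]_n) :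
  (forall k, \tr (A ^+ k) = \tr (B ^+ k)) ->
  forall k, \tr ((A + 1) ^+ k) = \tr ((B + 1) ^+ k).
Proof.
(* The extra factor [A ^+ i] closes the induction: one factor [A + 1] splits into the exponents
   [i.+1] and [i]. *)
move=> trAB k; suff: forall i,
    \tr (A ^+ i * (A + 1) ^+ k) = \tr (B ^+ i * (B + 1) ^+ k).
  by move/(_ 0%N); rewrite !expr0 !mul1r.
elim: k => [|k IHk] i; first by rewrite !expr0 !mulr1.
have step p (C : 'M[R]_p) : C ^+ i * (C + 1) ^+ k.+1 =
    C ^+ i.+1 * (C + 1) ^+ k + C ^+ i * (C + 1) ^+ k.
  by rewrite exprS mulrA mulrDr mulr1 -exprSr mulrDl.
by rewrite !step !mxtraceD !IHk.
Qed.

(* [true] stands for A and [false] for the all-ones matrix. *)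
Definition word_mx (R : pzRingType) n (A : 'M[R]_n) (w : seq bool) : 'M_n :=
  \prod_(b <- w) (if b then A else const_mx 1).

(** * Words in a matrix A and the all-ones matrix J *)

Section Words.
Variable R : comPzRingType.

(** J has rank one: with e the all-ones column, J = e e^T, so J X J = e (e^T X e) e^T, and the
    scalar e^T X e is tr(J X). *)
Lemma ones_sandwich n (X : 'M[R]_n) :
  const_mx 1 * X * const_mx 1 = \tr (const_mx 1 * X) *: const_mx 1.
Proof.
apply/matrixP=> i j; rewrite -!mulmxE !mxE mulr1; apply: eq_bigr => k _.
by rewrite !mxE mulr1; apply: eq_bigr => l _; rewrite !mxE.
Qed.

Lemma word_mx_cat n (A : 'M[R]_n) u v :
  word_mx A (u ++ v) = word_mx A u * word_mx A v.
Proof. by rewrite /word_mx big_cat. Qed.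

Lemma word_mx_cons n (A : 'M[R]_n) b v :
  word_mx A (b :: v) = (if b then A else const_mx 1) * word_mx A v.
Proof. by rewrite /word_mx big_cons. Qed.

Lemma word_mx_rcons n (A : 'M[R]_n) b v :
  word_mx A (rcons v b) = word_mx A v * (if b then A else const_mx 1).
Proof. by rewrite -cats1 word_mx_cat word_mx_cons /word_mx big_nil mulr1. Qed.

(** Cyclicity of the trace rotates a chosen J to the front. *)
Lemma trace_word_false n (A : 'M[R]_n) u v :
  \tr (word_mx A (u ++ false :: v)) = \tr (const_mx 1 * word_mx A (v ++ u)).
Proof.
by rewrite !word_mx_cat word_mx_cons -!mulmxE mxtrace_mulC mulmxA.
Qed.

Lemma trace_word_split n (A : 'M[R]_n) u v :
  \tr (const_mx 1 * word_mx A (u ++ false :: v)) =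
  \tr (const_mx 1 * word_mx A u) * \tr (const_mx 1 * word_mx A v).
Proof.
rewrite word_mx_cat word_mx_cons /= !mulrA ones_sandwich.
by rewrite -[_ * word_mx A v]scalemxAl mxtraceZ.
Qed.

Lemma word_mx_nseq n (A : 'M[R]_n) k : word_mx A (nseq k true) = A ^+ k.
Proof. by rewrite /word_mx big_nseq -Monoid.iteropE. Qed.

End Words.

(** * Word traces determined by the power traces of A and J - A *)

Lemma false_or_nseq (w : seq bool) :
  (exists u v, w = u ++ false :: v) \/ w = nseq (size w) true.
Proof.
case: (boolP (false \in w)) => [/splitPr[u v]|]; first by left; exists u, v.
move=> wT; right; apply/all_pred1P/allP=> -[] //=.
by rewrite (negbTE wT).
Qed.

Theorem trace_word_determined m n (A : 'M[algC]_m) (B : 'M[algC]_n) :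
  (forall k, \tr (A ^+ k) = \tr (B ^+ k)) ->
  (forall k, \tr ((const_mx 1 - A) ^+ k) = \tr ((const_mx 1 - B) ^+ k)) ->
  forall w, \tr (word_mx A w) = \tr (word_mx B w).
Proof.
move=> trAB trJAB.
(* A word containing J can be rotated to start with J; any other word is a power of the matrix. *)
suff total k : forall w, (size w <= k)%N ->
    \tr (const_mx 1 * word_mx A w) = \tr (const_mx 1 * word_mx B w).
  move=> w; case: (false_or_nseq w) => [[u [v ->]]|->]; last by rewrite !word_mx_nseq.
  by rewrite !trace_word_false (total (size (v ++ u))).
have [s] := ubnP k; elim: s k => // s IHs k; rewrite ltnS => le_ks w le_wk.
have {}IHs u : (size u < k)%N ->
    \tr (const_mx 1 * word_mx A u) = \tr (const_mx 1 * word_mx B u).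
  by case: k le_ks {le_wk} => // k lt_ks le_uk; apply: (IHs k).
(* A J beyond the leading one factors the trace over [u] and [v], both short enough for the
   induction hypothesis. *)
have mixed u v : (size (u ++ v) < k)%N ->
    \tr (const_mx 1 * word_mx A (u ++ false :: v)) =
    \tr (const_mx 1 * word_mx B (u ++ false :: v)).
  rewrite size_cat => lt_uvk; rewrite !trace_word_split !IHs //.
    by apply: leq_ltn_trans lt_uvk; apply: leq_addl.
  by apply: leq_ltn_trans lt_uvk; apply: leq_addr.
case: (false_or_nseq w) => [[u [v eqw]]|eqw].
  rewrite eqw mixed //; apply: leq_trans le_wk.
  by rewrite eqw !size_cat /= addnS.
move: le_wk; rewrite leq_eqVlt => /orP[/eqP sz_w|]; last exact: IHs.
rewrite {}eqw {}sz_w {w}.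
apply/eqP; rewrite -subr_eq0; set delta := _ - _; apply/eqP.
(* Among words of length k+1, only those with exactly one J can have different
   traces for A and B, and the difference is then delta. *)
have word w : size w = k.+1 -> \tr (word_mx A w) - \tr (word_mx B w) =
    (count_mem false w == 1)%:R * delta.
  move=> sz_w; case: (false_or_nseq w) => [[u [v eqw]]|->]; last first.
    by rewrite !word_mx_nseq trAB subrr count_nseq mul0r.
  have sz_vu : size (v ++ u) = k.
    by move: sz_w; rewrite eqw !size_cat /= addnS addnC => -[].
  rewrite eqw !trace_word_false count_cat /= addnCA -count_cat.
  rewrite (_ : count _ _ = count_mem false (v ++ u)); last first.
    by rewrite !count_cat addnC.
  case: (false_or_nseq (v ++ u)) => [[u' [v' eq_vu]]|->]; last first.
    by rewrite sz_vu count_nseq mul1r.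
  rewrite eq_vu mixed ?subrr; last first.
    by rewrite -sz_vu eq_vu !size_cat /= addnS.
  by rewrite count_cat /= !add1n addnS /= mul0r.
(* Expansion of the power behind a fixed prefix [w]. If [w] has one J, every remaining factor must
   contribute -A, with sign (-1)^i; two or more J give 0; with no J, the single J sits in one of [i]
   factors, with sign (-1)^(i-1). *)
have expand i w : (size w + i)%N = k.+1 ->
    \tr (word_mx A w * (const_mx 1 - A) ^+ i) -
    \tr (word_mx B w * (const_mx 1 - B) ^+ i) =
    (if count_mem false w is c.+1 then (c == 0)%:R * (-1) ^+ i * delta
     else - (i%:R * (-1) ^+ i * delta)).
  elim: i w => [|i IHi] w sz_w.
    rewrite !expr0 !mulr1 word; last by rewrite -sz_w addn0.
    by case: count => [|c]; rewrite ?mulr1 // !mul0r oppr0.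
  have step p (C : 'M[algC]_p) : word_mx C w * (const_mx 1 - C) ^+ i.+1 =
      word_mx C (rcons w false) * (const_mx 1 - C) ^+ i -
      word_mx C (rcons w true) * (const_mx 1 - C) ^+ i.
    by rewrite exprS mulrA mulrBr mulrBl !word_mx_rcons.
  rewrite !step !linearB /= opprD addrACA -opprD.
  have sz b : (size (rcons w b) + i)%N = k.+1 by rewrite size_rcons addSnnS.
  rewrite !IHi // -!cats1 !count_cat /= !addn0 addn1.
  case: count => [|c] /=.
    by rewrite opprK exprS -[i.+1%:R]natr1; ring.
  by rewrite exprS; ring.
(* For the empty prefix the left side vanishes by [trJAB], leaving (k+1) (-1)^(k+1) delta = 0 in
   characteristic 0. *)
have /eqP := expand k.+1 [::] (erefl _).
rewrite /word_mx !big_nil !mul1r trJAB subrr /= eq_sym oppr_eq0 !mulf_eq0.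
by rewrite pnatr_eq0 signr_eq0 => /eqP.
Qed.

Theorem gen_cospectral_trace_word (G H : sgraph) w :
  gen_cospectral G H ->
  \tr (word_mx (adjmx G) w) = \tr (word_mx (adjmx H) w).
Proof.
case=> coGH coGHc; apply: trace_word_determined => k.
  exact: cospectral_trace.
have eqJ (K : sgraph) : const_mx 1 - adjmx K = adjmx (compl K) + 1.
  by rewrite adjmx_compl addrAC subrK.
rewrite !eqJ; apply: trace_expr_add1 => i.
exact: (cospectral_trace i coGHc).
Qed.

(* Expanding each complement factor as J - 1 - A leaves words only. *)
Lemma gen_cospectral_trace_walk (G H : sgraph) (b : seq bool) :
  gen_cospectral G H ->
  \tr (\prod_(c <- b) (if c then adjmx G else adjmx (compl G))) =
  \tr (\prod_(c <- b) (if c then adjmx H else adjmx (compl H))).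
Proof.
move=> coGH; pose W K := \prod_(c <- b) (if c then adjmx K else adjmx (compl K)).
(* The prefix [w] collects the letters already expanded, so that the induction on [b] goes
   through. *)
rewrite -/(W G) -/(W H); suff: forall w,
    \tr (word_mx (adjmx G) w * W G) = \tr (word_mx (adjmx H) w * W H).
  by move/(_ [::]); rewrite /word_mx !big_nil !mul1r.
rewrite {}/W; elim: b => [|c b IHb] w.
  by rewrite !big_nil !mulr1; apply: gen_cospectral_trace_word.
rewrite !big_cons !mulrA; case: c.
  by have := IHb (rcons w true); rewrite !word_mx_rcons.
have step (K : sgraph) : word_mx (adjmx K) w * adjmx (compl K) =
    word_mx (adjmx K) (rcons w false) - word_mx (adjmx K) w -
    word_mx (adjmx K) (rcons w true).
  by rewrite adjmx_compl !mulrBr mulr1 !word_mx_rcons.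
by rewrite !step !mulrBl !linearB /= !IHb.
Qed.

(** * Walks counted by matrix products *)

Section CountingWalks.
Variables (T : finType) (r : bool -> rel T).

Definition is_walk k (b : k.-tuple bool) (v : {ffun 'I_k.+1 -> T}) :=
  [forall i : 'I_k,
    r (tnth b i) (v (widen_ord (leqnSn k) i)) (v (lift ord0 i))].

Definition walks_between k (b : k.-tuple bool) x y :=
  #|[pred v : {ffun 'I_k.+1 -> T} |
      [&& v ord0 == x, v ord_max == y & is_walk b v]]|.

Definition ffun_cons k x (v : {ffun 'I_k -> T}) : {ffun 'I_k.+1 -> T} :=
  [ffun i => oapp v x (unlift ord0 i)].

Lemma is_walk_cons k c (b : k.-tuple bool) x (v : {ffun 'I_k.+1 -> T}) :
  is_walk [tuple of c :: b] (ffun_cons x v) = r c x (v ord0) && is_walk b v.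
Proof.
have widen0 : widen_ord (leqnSn k.+1) ord0 = ord0 by apply: val_inj.
have widenS (j : 'I_k) : widen_ord (leqnSn k.+1) (lift ord0 j) =
    lift ord0 (widen_ord (leqnSn k) j) by apply: val_inj.
apply/forallP/andP => [walk|[rv /forallP walk] i].
  split; first by have := walk ord0; rewrite widen0 !ffunE unlift_none liftK.
  by apply/forallP=> j; have := walk (lift ord0 j); rewrite widenS !ffunE !liftK tnthS.
case: (unliftP ord0 i) => [j ->|->]; first by rewrite widenS !ffunE !liftK tnthS.
by rewrite widen0 !ffunE unlift_none liftK.
Qed.

(** Cuts a walk after its first step, [z] being its second vertex; this matches the row expansion of
    a matrix product. *)
Lemma walks_between_cons k c (b : k.-tuple bool) x y :
  walks_between [tuple of c :: b] x y =
  (\sum_z r c x z * walks_between b z y)%N.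
Proof.
pose tail (v : {ffun 'I_k.+2 -> T}) := [ffun i : 'I_k.+1 => v (lift ord0 i)].
rewrite /walks_between -sum1_card (reindex_onto (ffun_cons x) tail); last first.
  move=> v /andP[/eqP v0 _]; apply/ffunP=> i; rewrite ffunE.
  by case: (unliftP ord0 i) => [j ->|->] /=; rewrite ?ffunE.
rewrite (partition_big (fun v : {ffun 'I_k.+1 -> T} => v ord0) xpredT) //=.
apply: eq_bigr => z _.
have tailK v : tail (ffun_cons x v) = v.
  by apply/ffunP=> i; rewrite !ffunE liftK.
have max v : ffun_cons x v ord_max = v ord_max.
  rewrite ffunE (_ : ord_max = lift ord0 ord_max) ?liftK //.
  exact: val_inj.
have cond v : [&& ffun_cons x v ord0 == x, ffun_cons x v ord_max == y
    & is_walk [tuple of c :: b] (ffun_cons x v)] && (tail (ffun_cons x v) == v) &&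
    (v ord0 == z) = r c x z && [&& v ord0 == z, v ord_max == y & is_walk b v].
  rewrite max is_walk_cons tailK ffunE unlift_none /= !eqxx andbT /=.
  by case: (v ord0 =P z) => [->|_]; rewrite ?andbT ?andbF //= andbCA.
rewrite (eq_bigl _ _ cond) -sum1_card; case: (r c x z) => /=.
  by rewrite mul1n.
by rewrite big_pred0.
Qed.

Lemma walks_between_nil (b : 0.-tuple bool) x y :
  walks_between b x y = (x == y).
Proof.
rewrite /walks_between; case: eqP => [<-|neq_xy].
  rewrite (eq_card (B := pred1 [ffun => x])) ?card1 // => v; rewrite !inE.
  apply/idP/eqP => [/andP[/eqP v0 _]|->].
    by apply/ffunP=> i; rewrite ffunE ord1.
  by rewrite !ffunE eqxx; apply/forallP=> -[].
apply: eq_card0 => v; rewrite !inE (ord1 ord_max).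
by apply/negP=> /and3P[/eqP -> /eqP].
Qed.

Variable M : bool -> 'M[algC]_#|T|.
Hypothesis M_r : forall c i j, M c i j = (r c (enum_val i) (enum_val j))%:R.

Lemma walks_betweenE k (b : k.-tuple bool) i j :
  (\prod_(c <- b) M c) i j = (walks_between b (enum_val i) (enum_val j))%:R.
Proof.
elim: k => [|k IHk] in b i j *.
  rewrite walks_between_nil (inj_eq enum_val_inj) tuple0 big_nil mxE.
  by case: (i == j).
case/tupleP: b => c b; rewrite big_cons -mulmxE mxE walks_between_cons.
rewrite natr_sum (reindex _ (onW_bij _ (@enum_val_bij T))); apply: eq_bigr => l _.
by rewrite M_r IHk natrM.
Qed.

(** Closed walks sorted by starting vertex are counted by the diagonal entries. *)
Lemma card_closed_walks k (b : k.-tuple bool) :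
  #|[pred v : {ffun 'I_k.+1 -> T} | (v ord_max == v ord0) && is_walk b v]|%:R =
  \tr (\prod_(c <- b) M c).
Proof.
rewrite -sum1_card.
rewrite (partition_big (fun v : {ffun 'I_k.+1 -> T} => v ord0) xpredT) //=.
rewrite natr_sum.
rewrite (reindex _ (onW_bij _ (@enum_val_bij T))); apply: eq_bigr => i _.
rewrite walks_betweenE /walks_between -sum1_card; congr _%:R.
apply: eq_bigl => v; rewrite !inE.
by case: (v ord0 =P _) => [->|_]; rewrite ?andbT ?andbF.
Qed.
End CountingWalks.

Lemma n_walks_trace k (b : k.-tuple bool) (G : sgraph) :
  (n_walks b G)%:R = \tr (\prod_(c <- b) (if c then adjmx G else adjmx (compl G))).
Proof.
rewrite -(card_closed_walks (r := fun c => if c then @adj G else @compl_adj G)).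
  rewrite /n_walks cardsE; congr _%:R; apply: eq_card => v; rewrite !inE.
  congr (_ && _); apply: eq_forallb => i.
  by rewrite /=; case: (tnth b i).
by move=> [] i j; rewrite mxE.
Qed.

Lemma gen_cospectral_n_walks k (b : k.-tuple bool) (G H : sgraph) :
  gen_cospectral G H -> n_walks b G = n_walks b H.
Proof.
move=> coGH; apply/eqP; rewrite -(eqr_nat algC) !n_walks_trace.
by rewrite (gen_cospectral_trace_walk b coGH).
Qed.

(** * Isomorphism and induced subgraphs *)

Lemma iso_refl G : iso G G.
Proof. by exists id => //; exists id. Qed.

Lemma iso_sym G H : iso G H -> iso H G.
Proof.
case=> f [g fK gK] f_adj; exists g; first by exists f.
by move=> x y; rewrite -f_adj !gK.
Qed.

Lemma iso_trans G H K : iso G H -> iso H K -> iso G K.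
Proof.
case=> f bij_f f_adj [g bij_g g_adj]; exists (g \o f); first exact: bij_comp.
by move=> x y; rewrite /= g_adj f_adj.
Qed.

Lemma iso_card G H : iso G H -> #|G| = #|H|.
Proof. by case=> f /bij_eq_card. Qed.

(** The witness is the image of [S] under the embedding [g] of H into G. *)
Lemma induced_in_trans K H G : induced_in K H -> induced_in H G -> induced_in K G.
Proof.
case=> S isoS [T isoT]; have [f bij_f f_adj] := iso_sym isoT.
pose g (x : H) : G := val (f x).
have g_inj : injective g by move=> x y /val_inj/(bij_inj bij_f).
exists (g @: S); apply: iso_trans isoS; apply: iso_sym.
have gS (x : induced S) : g (val x) \in g @: S by apply: imset_f; apply: valP.
exists (fun x => Sub (g (val x)) (gS x) : induced (g @: S)).
  apply: inj_card_bij.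
    by move=> x y /(congr1 val)/=/g_inj/val_inj.
  by rewrite !card_sig card_imset.
by move=> x y; rewrite /= /induced_adj /= -f_adj.
Qed.

(** Shows that a family avoided by some graph has no member without vertices, a size that [U_le]
    leaves out. *)
Lemma induced_in_empty (K G : sgraph) : #|K| = 0 -> induced_in K G.
Proof.
move=> K0; have noK x : x \in K -> False by move=> xK; rewrite (cardD1 x) xK in K0.
exists set0; have noS (x : induced (set0 : {set G})) : False.
  by case: x => x /=; rewrite inE.
exists (fun x => False_rect _ (noS x)) => [|x]; last by case: (noS x).
exists (fun y => False_rect _ (noK y isT)) => [x|y]; first by case: (noS x).
by case: (noK y isT).
Qed.

Lemma ind_gt0 K G : (0 < ind K G)%N <-> induced_in K G.
Proof.
split=> [/card_gt0P[S]|[S isoS]]; first by rewrite inE => /asboolP isoS; exists S.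
by apply/card_gt0P; exists S; rewrite inE; apply/asboolP.
Qed.


(** * Sums over isomorphism classes *)

Definition edge_iso k : rel {set {set 'I_k}} :=
  fun E E' => `[< iso (edge_graph E) (edge_graph E') >].

Definition edge_reps k : {set {set {set 'I_k}}} :=
  transversal (equivalence_partition (@edge_iso k) setT) setT.

Lemma sum_U_le (R : nmodType) l (f : sgraph -> R) :
  \sum_(H <- U_le l) f H =
  \sum_(1 <= k < l.+1) \sum_(E in edge_reps k) f (edge_graph E).
Proof.
rewrite /U_le big_flatten big_map /index_iota subn1.
by apply: eq_bigr => k _; rewrite big_map big_enum.
Qed.

Lemma edge_iso_equivalence k : equivalence_rel (@edge_iso k).
Proof.
move=> E1 E2 E3; split; first by apply/asboolP/iso_refl.
move=> /asboolP iso12; apply/asboolP/asboolP; apply: iso_trans => //.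
exact: iso_sym.
Qed.

Lemma iso_edge_graph (K : sgraph) :
  exists E : {set {set 'I_#|K|}}, iso K (edge_graph E).
Proof.
pose E := [set [set p.1; p.2] | p : 'I_#|K| * 'I_#|K| in
  [pred p | adj (enum_val p.1) (enum_val p.2)]].
exists E; exists enum_rank; first exact: enum_rank_bij.
move=> x y; rewrite /= /edge_adj (inj_eq enum_rank_inj).
apply/andP/idP => [[neq_xy /imsetP[[i j] /=]]|adj_xy].
  rewrite inE /= => adj_ij eq_ij.
  (* Equality of two unordered pairs leaves four cases: two force x = y, the others match the pairs
     up to order. *)
  have := set21 (enum_rank x) (enum_rank y); have := set22 (enum_rank x) (enum_rank y).
  rewrite eq_ij => /set2P y_ij /set2P x_ij.
  rewrite -(enum_rankK x) -(enum_rankK y); case: y_ij x_ij => eqy [] eqx.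
  - by case/eqP: neq_xy; apply: enum_rank_inj; rewrite eqx eqy.
  - by rewrite eqx eqy adj_sym.
  - by rewrite eqx eqy.
  by case/eqP: neq_xy; apply: enum_rank_inj; rewrite eqx eqy.
split; first by apply: contraTneq adj_xy => ->; rewrite adj_irr.
by apply/imsetP; exists (enum_rank x, enum_rank y); rewrite // inE /= !enum_rankK.
Qed.

(** Number the vertices to get some [E], then replace [E] by the representative of its block in the
    transversal. *)
Lemma iso_edge_reps (K : sgraph) :
  exists2 E, E \in edge_reps #|K| & iso K (edge_graph E).
Proof.
have [E isoE] := iso_edge_graph K.
have part : partition (equivalence_partition (@edge_iso #|K|) setT) setT.
  by apply: equivalence_partitionP => E1 E2 E3 _ _ _; apply: edge_iso_equivalence.
have trans := transversalP part.
set P := equivalence_partition _ _ in part trans.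
have PE : pblock P E \in P by rewrite pblock_mem // (cover_partition part) inE.
exists (transversal_repr E (edge_reps #|K|) (pblock P E)).
  exact: repr_mem_transversal trans _ _ PE.
apply: iso_trans isoE _; apply/asboolP; rewrite -/(edge_iso _ _).
rewrite -(pblock_equivalence_partition (D := setT)) ?inE //.
  exact: repr_mem_pblock trans _ _ PE.
by move=> E1 E2 E3 _ _ _; apply: edge_iso_equivalence.
Qed.

(** * Zeros of supporters and the conclusion *)

(** All terms are nonnegative, so the sum vanishes only if each term does. *)
Theorem supporter_eq0 (R : realType) F l (Phi : sgraph -> R) G :
  (forall H : sgraph, F H -> (0 < #|H| <= l)%N) ->
  supporter F l Phi -> Phi G = 0 <-> Forb F G.
Proof.
move=> F_le [d [d_iso PhiE d_ge0 dF_gt0 d_Forb]]; rewrite PhiE sum_U_le.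
have term_ge0 k E : (1 <= k < l.+1)%N ->
    0 <= d (@edge_graph k E) * (ind (edge_graph E) G)%:R.
  move=> k_l; apply: mulr_ge0; last exact: ler0n.
  by apply: d_ge0; rewrite card_ord.
split=> [sum0 K FK K_G|G_Forb]; last first.
  rewrite big_nat big1 // => k k_l; apply: big1 => E _.
  have [->|ind_neq0] := eqVneq (ind (edge_graph E) G) 0; first by rewrite mulr0.
  have /ind_gt0 E_G : (0 < ind (edge_graph E) G)%N by rewrite lt0n.
  (* A graph induced in G inherits membership in [Forb F], so its coefficient is 0. *)
  rewrite d_Forb ?mul0r ?card_ord // => K FK K_E.
  exact: G_Forb FK (induced_in_trans K_E E_G).
have /andP[K_gt0 K_le] := F_le K FK.
have [E E_rep isoKE] := iso_edge_reps K.
have k_iota : #|K| \in index_iota 1 l.+1 by rewrite mem_index_iota K_gt0 ltnS.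
have inner_ge0 k : (1 <= k < l.+1)%N ->
    0 <= \sum_(E in edge_reps k) d (edge_graph E) * (ind (edge_graph E) G)%:R.
  by move=> k_l; apply: sumr_ge0 => E' _; apply: term_ge0.
move/eqP: sum0; rewrite big_nat psumr_eq0 // => /allP/(_ _ k_iota).
rewrite -mem_index_iota k_iota /= => /eqP sum0.
have term0 := psumr_eq0P _ sum0 E_rep.
have /eqP : d (edge_graph E) * (ind (edge_graph E) G)%:R = 0.
  by apply: term0 => E' _; apply: term_ge0; rewrite K_gt0.
(* Invariance of [d] carries positivity from [K] to its representative; the count must then be 0,
   although [K] occurs in G. *)
rewrite -(d_iso _ _ isoKE) mulf_eq0 (gt_eqF (dF_gt0 _ FK)) pnatr_eq0 /= -leqn0.
apply/negP; rewrite -ltnNge; apply/ind_gt0.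
by case: K_G => S isoS; exists S; apply: iso_trans isoS isoKE.
Qed.

Theorem theorem4p5 (R : realType) (B : forall k : nat, {set k.-tuple bool})
    (F : sgraph -> Prop) :
  (forall k : nat, (0 < k)%N -> orbit_representatives (B k)) ->
  iso_closed F ->
  antichain F ->
  (exists l : nat,
     (forall H : sgraph, F H -> (#|H| <= l)%N) /\
     exists Phi : sgraph -> R, supporter F l Phi /\ walk_realizable B l Phi) ->
  gen_spectrally_closed (Forb F).
Proof.
move=> _ _ _ [l [F_le [Phi [Phi_supp [a PhiE]]]]] G H G_Forb H_notForb coGH.
(* An empty member of F would be induced in G, against [G_Forb]. *)
have F_size K : F K -> (0 < #|K| <= l)%N.
  move=> FK; rewrite (F_le K FK) andbT lt0n; apply/eqP=> K0.
  exact: G_Forb FK (induced_in_empty G K0).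
apply/H_notForb/(supporter_eq0 H F_size Phi_supp).
rewrite -((supporter_eq0 G F_size Phi_supp).2 G_Forb) !PhiE.
apply: eq_bigr => k _; apply: eq_bigr => b _.
by rewrite (gen_cospectral_n_walks b coGH).
Qed.
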